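(* Let $\xi=(G,\mathcal{L},\mathcal{A})$ be a triplet whose multigraph $G$ is not strongly connected. Let $G_1\subset G$ be any closed submultigraph (nonempty and proper), i.e. such that all vertices reachable from $G_1$ belong to $G_1$, and let $G_2=G\setminus G_1$. Denote by $\xi_i$ the restriction of $\xi$ to $G_i$, $i=1,2$. Then $$\rho(\xi)=\max\{\rho(\xi_1),\rho(\xi_2)\}.$$
   Context: A triplet (system) $\xi=(G,\mathcal{L},\mathcal{A})$ consists of: a finite directed multigraph $G$ with vertices $1,\dots,n$ (loops and multiple edges allowed, finitely many edges); real linear spaces $\mathcal{L}=(L_1,\dots,L_n)$ with $1\le\dim L_i<\infty$, $L_i$ attached to vertex $i$; and, for every edge from $i$ to $j$, a linear operator $A_{ji}:L_i\to L_j$. $\mathcal{A}$ is the family of all these operators. The restriction of $\xi$ to a submultigraph given by a set of vertices consists of these vertices with their spaces, all edges of $G$ connecting vertices of this set, and the operators of those edges. $G\setminus G_1$ is the submultigraph on the vertices not in $G_1$. A multigraph is strongly connected if for every pair of vertices there is a path from one to the other (in both directions). A path $\alpha$ is a sequence of consecutive edges; $|\alpha|$ is its number of edges. For a path $i_1\to i_2\to\dots\to i_{k+1}$ with operators $A_{i_{s+1}i_s}$, $\Pi_\alpha=A_{i_{k+1}i_k}\cdots A_{i_2i_1}:L_{i_1}\to L_{i_{k+1}}$. A multinorm is a collection of norms $\|\cdot\|_i$ on $L_i$, $i=1,\dots,n$; for an operator $A:L_i\to L_j$, $\|A\|=\sup_{\|x\|_i=1}\|Ax\|_j$. The joint spectral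 radius is $\rho(\xi)=\lim_{k\to\infty}\max_{|\alpha|=k}\|\Pi_\alpha\|^{1/k}$ (the limit exists and does not depend on the multinorm; a maximum over an empty set is $0$). *)

(* Defs.v *)
From HB Require Import structures.
From mathcomp Require Import all_boot all_order all_algebra.
From mathcomp Require Import all_classical all_reals all_analysis.

Set Implicit Arguments.
Unset Strict Implicit.
Unset Printing Implicit Defensive.

Import Order.TTheory GRing.Theory Num.Theory.
Import numFieldNormedType.Exports.

Local Open Scope classical_set_scope.
Local Open Scope ring_scope.

Record triplet (R : realType) := Triplet {
  vertex : finType;
  edge : finType;
  src : edge -> vertex;
  tgt : edge -> vertex;
  space : vertex -> vectType R;
  dim_space : forall i, (1 <= \dim {:space i})%N;
  oper : forall e : edge, 'Hom(space (src e), space (tgt e)) }.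

Definition adj (R : realType) (xi : triplet R) : rel (vertex xi) :=
  fun i j => [exists e : edge xi, (src e == i) && (tgt e == j)].

(* [connect] allows the empty path from a vertex to itself. *)
Definition reachable (R : realType) (xi : triplet R) (i j : vertex xi) : bool :=
  connect (@adj R xi) i j.

Definition strongly_connected (R : realType) (xi : triplet R) : Prop :=
  forall i j : vertex xi, reachable i j.

Definition closed_vertices (R : realType) (xi : triplet R)
    (S : {set vertex xi}) : Prop :=
  forall i j : vertex xi, i \in S -> reachable i j -> j \in S.

Section Restriction.
Variables (R : realType) (xi : triplet R) (S : {set vertex xi}).

Definition sub_vertex : finType := {i : vertex xi | i \in S}.

Definition sub_edge : finType :=
  {e : edge xi | (src e \in S) && (tgt e \in S)}.

Definition sub_src (e : sub_edge) : sub_vertex :=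
  exist _ (src (sval e)) (proj1 (andP (svalP e))).

Definition sub_tgt (e : sub_edge) : sub_vertex :=
  exist _ (tgt (sval e)) (proj2 (andP (svalP e))).

Definition restriction : triplet R :=
  @Triplet R sub_vertex sub_edge sub_src sub_tgt
    (fun i => space (sval i)) (fun i => dim_space (sval i))
    (fun e => oper (sval e)).

End Restriction.

(* [walk i j k] is the type of the paths with [k] edges from [i] to [j];
   [walkS e w] appends the edge [e] at the end of [w]. *)
Inductive walk (R : realType) (xi : triplet R) (i : vertex xi) :
    vertex xi -> nat -> Type :=
| walk0 : walk i i 0
| walkS (k : nat) (e : edge xi) of walk i (src e) k : walk i (tgt e) k.+1.

Fixpoint walk_prod (R : realType) (xi : triplet R) (i j : vertex xi) (k : nat)
    (w : walk i j k) : 'Hom(space i, space j) :=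
  match w with
  | walk0 => \1%VF
  | walkS _ e w' => (oper e \o walk_prod w')%VF
  end.

(* Nonnegativity, and the value [0] at the origin, follow from these axioms. *)
Definition is_norm (R : realType) (V : vectType R) (nu : V -> R) : Prop :=
  [/\ forall x y : V, nu (x + y) <= nu x + nu y,
      forall (a : R) (x : V), nu (a *: x) = `|a| * nu x
    & forall x : V, nu x = 0 -> x = 0].

Record multinorm (R : realType) (xi : triplet R) := Multinorm {
  mnorm : forall i : vertex xi, space i -> R;
  mnormP : forall i : vertex xi, is_norm (@mnorm i) }.

Definition opnorm (R : realType) (xi : triplet R) (N : multinorm xi)
    (i j : vertex xi) (A : 'Hom(space i, space j)) : R :=
  sup [set mnorm N (A x) | x in [set x : space i | mnorm N x = 1]].

(* There are finitely many paths with [k] edges, so this supremum is a maximum;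
   [sup set0 = 0] gives the value for graphs without paths of length [k].  The
   value at [k = 0] has no effect on the limit. *)
Definition max_walk_norm (R : realType) (xi : triplet R) (N : multinorm xi)
    (k : nat) : R :=
  sup [set r : R | exists (i j : vertex xi) (w : walk i j k),
                     r = opnorm N (walk_prod w) `^ (k%:R^-1)].

(* The limit exists and is the same for all multinorms [N] of [xi]. *)
Definition jsr (R : realType) (xi : triplet R) (N : multinorm xi) : R :=
  limn (max_walk_norm N).

(* Main.v *)
Require Import Defs.
From mathcomp Require Import all_boot all_order all_algebra.
From mathcomp Require Import all_classical all_reals all_analysis.
From mathcomp Require Import ring.

Import Order.TTheory GRing.Theory Num.Theory.
Import numFieldNormedType.Exports.
Import VectorInternalTheory.

Local Open Scope ring_scope.

(** Call a rate [rho] admissible for a system when all products along paths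
    satisfy [|Pi_alpha x| <= C rho^|alpha| |x|] with one constant [C].  The joint
    spectral radius is the infimum of the positive admissible rates, and this
    description makes the theorem almost a matter of inspection:

    - Admissibility does not depend on the multinorm
      ([growth_bounded_indep]), because any two norms on a finite-dimensional
      space are equivalent.  So the two parts can be measured with the
      restrictions of the multinorm of the whole system.
    - A path of a subsystem is a path of the whole system, so passing to a
      restriction keeps every admissible rate; hence each [jsr] of a part is at
      most [jsr] of the whole ([jsr_restriction_le]).
    - A closed set of vertices cannot be left.  A path therefore stays in the
      complement, or stays in the closed set, or is a path of the complement,
      one crossing edge, and a path of the closed set ([walk_crossing]).  In the
      last case the bounds for the two parts multiply, and the single crossing
      edge only costs a constant factor.  So a positive rate admissible for both
      parts is admissible for the whole ([growth_bounded_closed]).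

    The description of [jsr] by admissible rates rests on submultiplicativity,
    as in Fekete's lemma.  If the paths with [m] edges have norm below [rho^m],
    cutting an arbitrary path into blocks of [m] edges and a short remainder
    shows that [rho] is admissible ([growth_bounded_of_lt]); conversely, for an
    admissible [rho] the constant [C] disappears in the limit of [k]-th roots
    ([growth_bounded_near]).  Together these show that the sequence defining
    [jsr] converges, to the infimum of its terms of positive index
    ([max_walk_norm_cvg]).  *)

(** * Seminorms and norms on finite-dimensional spaces *)

(** Unlike norms, seminorms are stable under composition with a linear map, so
    that the comparison of norms and the boundedness of operators become the
    same statement. *)
Definition is_seminorm {R : realType} {V : vectType R} (p : V -> R) : Prop :=
  (forall x y, p (x + y) <= p x + p y) /\
  (forall (a : R) x, p (a *: x) = `|a| * p x).

Section SeminormTheory.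
Context {R : realType} {V : vectType R} {p : V -> R} (p_semi : is_seminorm p).

Lemma seminorm0 : p 0 = 0.
Proof. by rewrite -(scale0r 0) p_semi.2 normr0 mul0r. Qed.

Lemma seminorm_ge0 x : 0 <= p x.
Proof.
have := p_semi.1 x (- x).
rewrite subrr seminorm0 -scaleN1r p_semi.2 normrN1 mul1r => h.
by rewrite -(pmulrn_lge0 _ (isT : (0 < 2)%N)) mulr2n.
Qed.

Lemma seminorm_sum (I : Type) (s : seq I) (F : I -> V) :
  p (\sum_(i <- s) F i) <= \sum_(i <- s) p (F i).
Proof.
elim: s => [|i s IH]; first by rewrite !big_nil seminorm0.
by rewrite !big_cons (le_trans (p_semi.1 _ _))// lerD2l.
Qed.

Lemma seminorm_lipschitz x y : `|p x - p y| <= p (x - y).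
Proof.
have half u v : p u - p v <= p (u - v).
  by rewrite lerBlDr -{1}(subrK v u) p_semi.1.
rewrite ler_norml half andbT lerNl opprB (le_trans (half y x))//.
by rewrite -opprB -scaleN1r p_semi.2 normrN1 mul1r.
Qed.

(** Expanding a vector in the basis of coordinates bounds the seminorm by the
    sum of its values on the basis vectors; this gives the continuity that the
    compactness argument below needs. *)
Lemma seminorm_le_mx_norm : exists2 D : R, 0 <= D &
  forall u, p (r2v u) <= D * `|u|.
Proof.
pose e j := r2v (delta_mx 0 j) : V.
exists (\sum_j p (e j)) => [|u].
  by apply: sumr_ge0 => j _; exact: seminorm_ge0.
rewrite {1}[u]row_sum_delta linear_sum (le_trans (seminorm_sum _ _ _))//.
rewrite mulr_suml; apply: ler_sum => j _.
rewrite linearZ p_semi.2 mulrC; apply: ler_wpM2l; first exact: seminorm_ge0.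
rewrite [leRHS]/Num.norm/= mx_normrE.
exact: (le_bigmax _ (fun ij : 'I_1 * 'I__ => `|u ij.1 ij.2|) (0, j)).
Qed.

End SeminormTheory.

Lemma norm_seminorm {R : realType} {V : vectType R} {nu : V -> R} :
  is_norm nu -> is_seminorm nu.
Proof. by case. Qed.

Lemma norm_gt0 {R : realType} {V : vectType R} {nu : V -> R} (x : V) :
  is_norm nu -> x != 0 -> 0 < nu x.
Proof.
move=> nuP x0; rewrite lt_neqAle (seminorm_ge0 (norm_seminorm nuP)) andbT eq_sym.
by apply: contra_neq x0; case: nuP => _ _; apply.
Qed.

(** A norm is continuous in the coordinates, so it attains a minimum on the
    unit sphere of the sup norm, which is compact; the minimum is positive
    because the norm is definite, and homogeneity does the rest. *)
Lemma mx_norm_le_norm {R : realType} {V : vectType R} {nu : V -> R} :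
  is_norm nu -> exists2 E : R, 0 <= E &
  forall x, `|v2r x| <= E * nu x.
Proof.
move=> nuP; have nuS := norm_seminorm nuP.
pose sphere := [set u : 'rV[R]_(dim V) | `|u| = 1]%classic.
pose f (u : 'rV[R]_(dim V)) := nu (r2v u).
(* The sphere is empty exactly for the zero space. *)
have [sphere0|sphere_ne] := eqVneq sphere classical_sets.set0.
  exists 0 => // x; rewrite mul0r; set u := v2r x.
  have [->|u0] := eqVneq u 0; first by rewrite normr0.
  suff : sphere (`|u|^-1 *: u) by rewrite sphere0.
  by rewrite /sphere/= normrZ normfV normr_id mulVf// normr_eq0.
have sphere_cpt : compact sphere.
  apply: bounded_closed_compact.
    exists 1; split => // M M1 u /= hu; rewrite hu; exact: ltW.
  apply: (@preimage_closed _ _ (fun u : 'rV[R]_(dim V) => `|u|) [set 1 : R]%classic).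
    by move=> u _; exact: norm_continuous.
  exact: closed_eq.
have f_cont : continuous f.
  have [D D0 fD] := seminorm_le_mx_norm nuS.
  move=> u; apply: (cvgrPdist_le (FF := nbhs_filter u) f (f u)).2 => eps eps0.
  have D1 : 0 < D + 1 by rewrite ltr_wpDl.
  have e0 : 0 < eps / (D + 1) by rewrite divr_gt0.
  near=> v.
  rewrite (le_trans (seminorm_lipschitz nuS _ _))// -raddfB (le_trans (fD _))//.
  have : `|u - v| <= eps / (D + 1).
    near: v; apply: filterS (nbhsx_ballx u _ e0) => v.
    by rewrite -ball_normE/= => /ltW.
  rewrite ler_pdivlMr// mulrC; apply: le_trans.
  by rewrite ler_wpM2r// lerDl.
have [|u0 + umin] := compact_EVT_min _ sphere_cpt (continuous_subspaceT f_cont).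
  exact/set0P.
rewrite inE /sphere/= => u0_1.
have fu0 : 0 < f u0.
  apply: (norm_gt0 (r2v u0) nuP); apply/eqP => r0.
  suff : u0 = 0.
    by move=> u00; move: u0_1; rewrite u00 normr0 => /esym/eqP; rewrite oner_eq0.
  by apply: r2v_inj; rewrite r0 linear0.
exists (f u0)^-1 => [|x]; first by rewrite invr_ge0 ltW.
set u := v2r x.
have [->|un0] := eqVneq u 0.
  by rewrite normr0 mulr_ge0 ?invr_ge0 ?(ltW fu0)//; exact: seminorm_ge0.
have nu_gt0 : 0 < `|u| by rewrite normr_gt0.
have : f u0 <= f (`|u|^-1 *: u).
  by apply: umin; rewrite inE /sphere/= normrZ normfV normr_id mulVf// normr_eq0.
rewrite /f linearZ nuS.2 normfV normr_id/= v2rK.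
by rewrite ler_pdivlMl// ler_pdivlMl// mulrC.
Unshelve. all: by end_near. Qed.

(** Taking for [p] another norm, this is the equivalence of norms; taking a norm
    composed with a linear map, it is the boundedness of that map. *)
Lemma seminorm_le_norm {R : realType} {V : vectType R} {p nu : V -> R} :
  is_seminorm p -> is_norm nu ->
  exists2 C : R, 0 <= C & forall x, p x <= C * nu x.
Proof.
move=> pS nuP.
have [D D0 pD] := seminorm_le_mx_norm pS.
have [E E0 nuE] := mx_norm_le_norm nuP.
exists (D * E) => [|x]; first exact: mulr_ge0.
rewrite -{1}(v2rK x) (le_trans (pD _))//.
by rewrite -mulrA ler_wpM2l.
Qed.

Lemma norm_lfun_seminorm {R : realType} {V W : vectType R} {nu : W -> R}
  (A : 'Hom(V, W)) : is_norm nu -> is_seminorm (fun x => nu (A x)).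
Proof.
by move=> [D Z _]; split=> [x y|a x]; rewrite (linearD, linearZ)//; exact: Z.
Qed.

(** * Operator norms *)

Lemma sup_ge0 {R : realType} (E : set R) :
  (forall r, E r -> 0 <= r)%classic -> 0 <= sup E.
Proof.
move=> E0; have [supE|/sup_out -> //] := pselect (has_sup E).
have [r Er] := supE.1.
by rewrite (le_trans (E0 _ Er))// ub_le_sup//; exact: supE.2.
Qed.

Section OperatorNorm.
Context {R : realType} {xi : triplet R} (N : multinorm xi).

Lemma mnorm_seminorm (i : vertex xi) : is_seminorm (@mnorm _ _ N i).
Proof. exact: norm_seminorm (mnormP N i). Qed.

Lemma mnorm_ge0 i x : 0 <= @mnorm _ _ N i x.
Proof. exact: seminorm_ge0 (mnorm_seminorm i) x. Qed.

Lemma opnorm_ge0 {i j : vertex xi} (A : 'Hom(Defs.space i, Defs.space j)) : 0 <= opnorm N A.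
Proof. by apply: sup_ge0 => _ [x _ <-]; exact: mnorm_ge0. Qed.

Lemma opnorm_le {i j : vertex xi} (A : 'Hom(Defs.space i, Defs.space j)) c :
  0 <= c -> (forall x, mnorm N (A x) <= c * mnorm N x) -> opnorm N A <= c.
Proof.
move=> c0 Ac; rewrite /opnorm.
have [->|/set0P E0] := eqVneq
  [set mnorm N (A x) | x in [set x : Defs.space i | mnorm N x = 1]]%classic
  classical_sets.set0; first by rewrite sup0.
by apply: ge_sup => // _ [x /= x1 <-]; rewrite (le_trans (Ac x))// x1 mulr1.
Qed.

(** The supremum defining [opnorm] is over a bounded set because linear maps
    between finite-dimensional spaces are bounded; without that it would take
    the default value [0]. *)
Lemma le_opnorm {i j : vertex xi} (A : 'Hom(Defs.space i, Defs.space j)) x :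
  mnorm N (A x) <= opnorm N A * mnorm N x.
Proof.
have [->|x0] := eqVneq x 0.
  by rewrite linear0 !(seminorm0 (mnorm_seminorm _)) mulr0.
have nx0 : 0 < mnorm N x := norm_gt0 x (mnormP N i) x0.
have [C C0 AC] := seminorm_le_norm (norm_lfun_seminorm A (mnormP N j)) (mnormP N i).
rewrite -ler_pdivrMr//.
have -> : mnorm N (A x) / mnorm N x = mnorm N (A ((mnorm N x)^-1 *: x)).
  by rewrite linearZ (mnorm_seminorm j).2 ger0_norm ?invr_ge0 ?mnorm_ge0// mulrC.
apply: ub_le_sup.
  by exists C => _ [y /= y1 <-]; rewrite (le_trans (AC y))// y1 mulr1.
exists ((mnorm N x)^-1 *: x) => //=.
by rewrite (mnorm_seminorm i).2 ger0_norm ?invr_ge0 ?mnorm_ge0// mulVf// gt_eqF.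
Qed.

End OperatorNorm.

(** * The joint spectral radius and exponential growth of path products *)

Section WalkGrowth.
Context {R : realType} {xi : triplet R}.
Implicit Types (N : multinorm xi) (rho : R).

(** The product of a path grows at most like the powers of [rho], up to a factor
    common to all paths.  The bound is put on vectors rather than on operator
    norms, so that paths are concatenated by plain substitution. *)
Definition growth_bounded N rho : Prop := exists2 C : R, 0 <= C &
  forall (i j : vertex xi) k (w : walk i j k) x,
    mnorm N (walk_prod w x) <= C * rho ^+ k * mnorm N x.

Lemma edge_bound N : exists2 B : R, 1 <= B &
  forall (e : edge xi) x, mnorm N (oper e x) <= B * mnorm N x.
Proof.
exists (\big[Num.max/1]_(e : edge xi) opnorm N (oper e)) => [|e x].
  exact: bigmax_ge_id.
rewrite (le_trans (le_opnorm N _ _))// ler_wpM2r ?mnorm_ge0//.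
exact: le_bigmax.
Qed.

Lemma walk_bound N (B : R) : 0 <= B ->
  (forall (e : edge xi) x, mnorm N (oper e x) <= B * mnorm N x) ->
  forall (i j : vertex xi) k (w : walk i j k) x,
    mnorm N (walk_prod w x) <= B ^+ k * mnorm N x.
Proof.
move=> B0 eB i j k; elim=> [|{}k e w IH] x /=.
  by rewrite id_lfunE expr0 mul1r.
by rewrite comp_lfunE (le_trans (eB _ _))// exprS -mulrA ler_wpM2l.
Qed.

(** The length is a variable with an equation, rather than [a + b] itself,
    because paths are indexed by their length: rewriting that index would change
    the type of the path. *)
Lemma walk_split {i j : vertex xi} {k} (w : walk i j k) a b : k = (a + b)%N ->
  exists m (u : walk i m a) (v : walk m j b),
    forall x, walk_prod w x = walk_prod v (walk_prod u x).
Proof.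
elim: w a b => [|{}k e w IH] a b.
  case: a => [|//]; case: b => [|//] _.
  exists i, (walk0 i), (walk0 i) => x; rewrite /= !id_lfunE//.
case: b => [|b].
  rewrite addn0 => <-; exists (tgt e), (walkS w), (walk0 (tgt e)) => x.
  by rewrite /= id_lfunE.
rewrite addnS => -[] /IH[m [u [v uv]]].
by exists m, u, (walkS v) => x; rewrite /= !comp_lfunE uv.
Qed.

Lemma powR_invn_expK k (a : R) : (0 < k)%N -> 0 <= a ->
  (a `^ (k%:R^-1)) ^+ k = a.
Proof.
move=> k0 a0; rewrite -powR_mulrn ?powR_ge0// -powRrM mulVf ?powRr1//.
by rewrite pnatr_eq0 -lt0n.
Qed.

Lemma max_walk_norm_ge0 N k : 0 <= max_walk_norm N k.
Proof. by apply: sup_ge0 => _ [i [j [w ->]]]; exact: powR_ge0. Qed.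

Lemma max_walk_norm_le N k c : (0 < k)%N -> 0 <= c ->
  (forall (i j : vertex xi) (w : walk i j k) x,
    mnorm N (walk_prod w x) <= c ^+ k * mnorm N x) ->
  max_walk_norm N k <= c.
Proof.
move=> k0 c0 wc; rewrite /max_walk_norm; set E := (X in sup X).
have [->|/set0P E0] := eqVneq E classical_sets.set0; first by rewrite sup0.
apply: ge_sup => // _ [i [j [w ->]]].
rewrite -(@ler_pXn2r _ k) ?nnegrE ?powR_ge0// powR_invn_expK ?opnorm_ge0//.
by apply: opnorm_le; [exact: exprn_ge0 | exact: wc].
Qed.

(** The supremum over paths is an upper bound since the edge norms, which are
    finitely many, have a common bound [B], and a path with [k] edges then has
    norm at most [B^k]. *)
Lemma le_max_walk_norm N {k} {i j : vertex xi} (w : walk i j k) x : (0 < k)%N ->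
  mnorm N (walk_prod w x) <= max_walk_norm N k ^+ k * mnorm N x.
Proof.
move=> k0; rewrite (le_trans (le_opnorm N _ _))// ler_wpM2r ?mnorm_ge0//.
rewrite -[leLHS](powR_invn_expK _ _ k0) ?opnorm_ge0//.
rewrite ler_pXn2r ?nnegrE ?powR_ge0 ?max_walk_norm_ge0//.
apply: ub_le_sup; last by exists i, j, w.
have [B B1 eB] := edge_bound N; have B0 : 0 <= B by rewrite (le_trans ler01).
exists B => _ [i' [j' [w' ->]]].
rewrite -(@ler_pXn2r _ k) ?nnegrE ?powR_ge0// powR_invn_expK ?opnorm_ge0//.
apply: opnorm_le; first exact: exprn_ge0.
exact: walk_bound.
Qed.

(** Submultiplicativity: every block of [m] consecutive edges contributes at most
    [rho^m], and the remaining fewer than [m] edges contribute at most the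
    corresponding power of a bound [B] for the edges. *)
Lemma growth_bounded_of_lt {N m rho} : (0 < m)%N -> max_walk_norm N m < rho ->
  growth_bounded N rho.
Proof.
move=> m0 m_lt; have rho0 : 0 < rho := le_lt_trans (max_walk_norm_ge0 N m) m_lt.
have [B B1 eB] := edge_bound N; have B0 : 0 <= B by rewrite (le_trans ler01).
have step i j (w : walk i j m) x :
    mnorm N (walk_prod w x) <= rho ^+ m * mnorm N x.
  rewrite (le_trans (le_max_walk_norm N w x m0))// ler_wpM2r ?mnorm_ge0//.
  by rewrite ler_pXn2r ?nnegrE ?max_walk_norm_ge0 ?ltW.
have blocks q (i j : vertex xi) k s (w : walk i j k) x : k = (q * m + s)%N ->
    mnorm N (walk_prod w x) <= rho ^+ (q * m) * B ^+ s * mnorm N x.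
  elim: q i k w x => [|q IH] i k w x.
    by move=> ks; move: w; rewrite {}ks mul0n expr0 mul1r => w; exact: walk_bound.
  rewrite mulSn -addnA => /(walk_split w)[n [u [v ->]]].
  rewrite (le_trans (IH _ _ _ _ (erefl _)))// exprD -!mulrA [leRHS]mulrCA.
  rewrite ler_wpM2l ?exprn_ge0 ?(ltW rho0)// [leRHS]mulrCA.
  by rewrite ler_wpM2l ?exprn_ge0.
(* [D] is at least [1], so [D ^+ m] absorbs the ratio [(B / rho) ^+ s] for every
   remainder [s < m]. *)
set D := Num.max (B / rho) 1.
have D1 : 1 <= D by rewrite /D le_max lexx orbT.
exists (D ^+ m) => [|i j k w x]; first by rewrite exprn_ge0 ?(le_trans ler01).
apply: le_trans (blocks _ _ _ _ _ w x (divn_eq k m)) _.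
rewrite ler_wpM2r ?mnorm_ge0// [in leRHS](divn_eq k m) exprD [leRHS]mulrCA.
rewrite ler_wpM2l ?exprn_ge0 ?(ltW rho0)//.
apply: (@le_trans _ _ (D ^+ (k %% m) * rho ^+ (k %% m))).
  rewrite -exprMn lerXn2r ?nnegrE ?mulr_ge0 ?(le_trans ler01 D1) ?(ltW rho0)//.
  by rewrite -ler_pdivrMr// /D le_max lexx.
by rewrite ler_wpM2r ?exprn_ge0 ?(ltW rho0)// ler_weXn2l// ltnW// ltn_mod.
Qed.

(** The constant of the growth bound is eventually smaller than
    [(rho' / rho)^k], so it is lost after taking [k]-th roots. *)
Lemma growth_bounded_near {N rho rho'} : 0 < rho < rho' ->
  growth_bounded N rho -> (\forall k \near \oo, max_walk_norm N k <= rho')%classic.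
Proof.
move=> /andP[rho0 lt_rho] [C C0 wC].
have rho'0 : 0 < rho' := lt_trans rho0 lt_rho.
have z1 : `|rho / rho'| < 1.
  by rewrite ger0_norm ?divr_ge0 ?ltW// ltr_pdivrMr// mul1r.
have /cvgrPdist_le/(_ 1 ltr01) small := cvg_geometric C z1.
near=> k.
have k0 : (0 < k)%N by near: k; exact: nbhs_infty_gt.
apply: max_walk_norm_le => //; first exact: ltW.
move=> i j w x; rewrite (le_trans (wC _ _ _ _ _))// ler_wpM2r ?mnorm_ge0//.
have : `|0 - geometric C (rho / rho') k| <= 1 by near: k.
rewrite sub0r normrN /geometric/= => /(le_trans (ler_norm _)).
by rewrite expr_div_n mulrA ler_pdivrMr ?exprn_gt0// mul1r.
Unshelve. all: by end_near. Qed.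

(** Each term of positive index is at least the infimum, and any term close to
    the infimum forces, by the two previous lemmas, almost all terms to be
    close to it.  The index [0] is left out: the exponent [0%:R^-1] is [0], so
    that term is not the norm of a product. *)
Lemma max_walk_norm_cvg N : (max_walk_norm N @ \oo -->
  inf [set max_walk_norm N k | k in [set k | (0 < k)%N]])%classic.
Proof.
set E := (X in inf X).
have lbE : has_lbound E by exists 0 => _ [k _ <-]; exact: max_walk_norm_ge0.
have E_inf : has_inf E by split => //; exists (max_walk_norm N 1); exists 1%N.
have infE0 : 0 <= inf E.
  by apply: lb_le_inf; [case: E_inf | move=> _ [k _ <-]; exact: max_walk_norm_ge0].
apply/cvgrPdist_le => eps eps0.
have [_ [m /= m0 <-] m_lt] := inf_adherent (divr_gt0 eps0 (ltr0Sn R 1)) E_inf.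
have gb := growth_bounded_of_lt m0 m_lt.
have bd : 0 < inf E + eps / 2%:R < inf E + eps.
  by rewrite ltr_wpDl ?divr_gt0//= ltrD2l ltr_pdivrMr// ltr_pMr// ltr1n.
near=> k.
have k0 : (0 < k)%N by near: k; exact: nbhs_infty_gt.
rewrite distrC ger0_norm; last by rewrite subr_ge0; apply: ge_inf => //; exists k.
rewrite lerBlDl; near: k.
exact: growth_bounded_near bd gb.
Unshelve. all: by end_near. Qed.

Lemma jsrE N :
  jsr N = inf [set max_walk_norm N k | k in [set k | (0 < k)%N]]%classic.
Proof. exact: cvg_lim (max_walk_norm_cvg N). Qed.

Lemma jsr_ge0 N : 0 <= jsr N.
Proof.
rewrite jsrE; apply: lb_le_inf; first by exists (max_walk_norm N 1); exists 1%N.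
by move=> _ [k _ <-]; exact: max_walk_norm_ge0.
Qed.

Lemma jsr_lt_growth_bounded {N rho} : jsr N < rho -> growth_bounded N rho.
Proof.
rewrite jsrE => /inf_lt[|_ [m /= m0 <-] m_lt].
  by exists (max_walk_norm N 1); exists 1%N.
exact: growth_bounded_of_lt m0 m_lt.
Qed.

Lemma growth_bounded_jsr_le {N rho} : 0 < rho ->
  growth_bounded N rho -> jsr N <= rho.
Proof.
move=> rho0 gb; apply/ler_addgt0Pr => eps eps0.
apply: (@closed_cvg _ _ \oo%classic _ (max_walk_norm N) (fun x => x <= rho + eps)).
- exact: closed_le.
- by apply: growth_bounded_near gb; rewrite rho0 ltrDl.
- by rewrite jsrE; exact: max_walk_norm_cvg.
Qed.

Lemma multinorm_equiv N N' : exists2 c : R, 0 <= c &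
  forall (i : vertex xi) x, @mnorm _ _ N i x <= c * mnorm N' x.
Proof.
have /boolp.choice[c cP] (i : vertex xi) : exists C : R,
    0 <= C /\ forall x, @mnorm _ _ N i x <= C * mnorm N' x.
  have [C C0 CP] := seminorm_le_norm (mnorm_seminorm N i) (mnormP N' i).
  by exists C.
exists (\big[Num.max/0]_i c i) => [|i x]; first exact: bigmax_ge_id.
by rewrite (le_trans ((cP i).2 x))// ler_wpM2r ?mnorm_ge0//; exact: le_bigmax.
Qed.

(** Replacing the multinorm multiplies the bounds at both ends of a path by
    constants that do not depend on its length. *)
Lemma growth_bounded_indep {N} N' {rho} : 0 <= rho ->
  growth_bounded N rho -> growth_bounded N' rho.
Proof.
move=> rho0 [C C0 wC].
have [c c0 cP] := multinorm_equiv N' N.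
have [d d0 dP] := multinorm_equiv N N'.
exists (c * C * d) => [|i j k w x]; first by rewrite !mulr_ge0.
rewrite (le_trans (cP _ _))// -!mulrA ler_wpM2l//.
rewrite (le_trans (wC _ _ _ _ _))// -mulrA ler_wpM2l//.
by rewrite mulrCA ler_wpM2l ?exprn_ge0.
Qed.

End WalkGrowth.

(** * Paths in a restriction *)

Section Restriction.
Context {R : realType} {xi : triplet R}.
Implicit Types (N : multinorm xi) (S T : {set vertex xi}) (rho : R).

Definition restrict_multinorm N T : multinorm (restriction T) :=
  @Multinorm R (restriction T) (fun i => @mnorm _ _ N (sval i))
    (fun i => mnormP N (sval i)).

Lemma walk_of_restriction {T} {i j : vertex (restriction T)} {k}
    (w : walk i j k) :
  exists w' : walk (sval i) (sval j) k,
    walk_prod w' = walk_prod w :> 'Hom(Defs.space (sval i), Defs.space (sval j)).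
Proof.
elim: w => [|{}k e w [w' ww']]; first by exists (walk0 (sval i)).
by exists (walkS (e := sval e) w'); rewrite /= ww'.
Qed.

Lemma growth_bounded_restriction N T rho :
  growth_bounded N rho -> growth_bounded (restrict_multinorm N T) rho.
Proof.
move=> [C C0 wC]; exists C => // i j k w x.
have [w' <-] := walk_of_restriction w.
exact: wC.
Qed.

Lemma walk_reachable {i j : vertex xi} {k} (w : walk i j k) : reachable i j.
Proof.
elim: w => [|{}k e w IH]; first exact: connect0.
apply: connect_trans IH (connect1 _).
by apply/existsP; exists e; rewrite !eqxx.
Qed.

(** The property that a closed set and its complement share, and under which a
    path with both ends in [T] is a path of the restriction to [T]. *)
Definition walk_convex T : Prop := forall i m j : vertex xi,
  i \in T -> j \in T -> reachable i m -> reachable m j -> m \in T.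

Lemma walk_in_restriction {T} (i j : vertex xi) k (w : walk i j k)
    (iT : i \in T) (jT : j \in T) : walk_convex T ->
  exists w' : @walk R (restriction T) (exist _ i iT) (exist _ j jT) k,
    walk_prod w' = walk_prod w :> 'Hom(Defs.space i, Defs.space j).
Proof.
move=> cT; elim: w jT => [|{}k e w IH] jT.
  (* Vertices and edges of the restriction carry membership proofs; these have
     to be identified before a path can be built. *)
  rewrite (bool_irrelevance jT iT).
  by exists (walk0 (xi := restriction T) (exist _ i iT)).
have eT : (src e \in T) && (tgt e \in T).
  rewrite jT andbT; apply: (cT _ _ _ iT jT (walk_reachable w)); apply: connect1.
  by apply/existsP; exists e; rewrite !eqxx.
pose e' : sub_edge T := exist _ e eT.
have [w' ww'] := IH (proj1 (andP (svalP e'))).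
rewrite (bool_irrelevance jT (proj2 (andP (svalP e')))).
exists (walkS (xi := restriction T) (e := e') w').
by rewrite /= ww'.
Qed.

Lemma growth_bounded_walk_convex {N T rho} : walk_convex T ->
  growth_bounded (restrict_multinorm N T) rho ->
  exists2 C : R, 0 <= C & forall (i j : vertex xi) k (w : walk i j k) x,
    i \in T -> j \in T ->
    mnorm N (walk_prod w x) <= C * rho ^+ k * mnorm N x.
Proof.
move=> cT [C C0 wC]; exists C => // i j k w x iT jT.
have [w' <-] := walk_in_restriction i j k w iT jT cT.
exact: (wC _ _ _ w' x).
Qed.

(** The crossing edge is the last edge of the path that starts outside [S];
    uniqueness of the crossing comes later, from the closedness of [S]. *)
Lemma walk_crossing {S} {i j : vertex xi} {k} (w : walk i j k) :
  i \notin S -> j \in S ->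
  exists e a b (u : walk i (src e) a) (v : walk (tgt e) j b),
    [/\ k = (a + b).+1, src e \notin S, tgt e \in S &
        forall x, walk_prod w x = walk_prod v (oper e (walk_prod u x))].
Proof.
move=> iS; elim: w => [|{}k e w IH] jS; first by rewrite jS in iS.
have [/IH[e' [a [b [u [v [kab sS tS uv]]]]]]|srcS] := boolP (src e \in S).
  exists e', a, b.+1, u, (walkS v); split => // [|x]; first by rewrite addnS kab.
  by rewrite /= !comp_lfunE uv.
exists e, k, 0%N, w, (walk0 (tgt e)); split => // [|x]; first by rewrite addn0.
by rewrite /= comp_lfunE id_lfunE.
Qed.

(** * Growth across the boundary of a closed set *)

Lemma closed_walk_convex S : closed_vertices S -> walk_convex S.
Proof. by move=> cS i m j iS _ im _; exact: cS iS im. Qed.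

Lemma closedC_walk_convex S : closed_vertices S -> walk_convex (finset.setC S).
Proof.
move=> cS i m j _; rewrite !finset.in_setC => jS _ mj.
by apply: contra jS => mS; exact: cS mS mj.
Qed.

(** A path stays on one side or crosses once into [S].  In the latter case its
    two pieces and the crossing edge give the constant [C1 * B * C2 / rho], where
    [1 / rho] makes up for the crossing edge, which contributes [B] instead of
    [rho]. *)
Lemma growth_bounded_closed N S rho : closed_vertices S -> 0 < rho ->
  growth_bounded (restrict_multinorm N S) rho ->
  growth_bounded (restrict_multinorm N (finset.setC S)) rho ->
  growth_bounded N rho.
Proof.
move=> cS rho0.
move=> /(growth_bounded_walk_convex (closed_walk_convex S cS))[C1 C10 wC1].
move=> /(growth_bounded_walk_convex (closedC_walk_convex S cS))[C2 C20 wC2].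
have [B B1 eB] := edge_bound N; have B0 : 0 <= B := le_trans ler01 B1.
have r0 k : 0 <= rho ^+ k by rewrite exprn_ge0// ltW.
have D0 : 0 <= C1 * B * C2 / rho by rewrite !mulr_ge0// invr_ge0 ltW.
exists (C1 + C2 + C1 * B * C2 / rho) => [|i j k w x]; first by rewrite !addr_ge0.
have weaken C : C <= C1 + C2 + C1 * B * C2 / rho ->
    mnorm N (walk_prod w x) <= C * rho ^+ k * mnorm N x ->
    mnorm N (walk_prod w x) <=
      (C1 + C2 + C1 * B * C2 / rho) * rho ^+ k * mnorm N x.
  move=> CD /le_trans; apply.
  by rewrite ler_wpM2r ?mnorm_ge0// ler_wpM2r.
have [iS|iS] := boolP (i \in S).
  have jS := cS _ _ iS (walk_reachable w).
  apply: (weaken C1); last exact: wC1.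
  by rewrite -addrA lerDl addr_ge0.
have [jS|jS] := boolP (j \in S); last first.
  apply: (weaken C2); last by apply: wC2; rewrite finset.in_setC.
  by rewrite addrAC lerDr addr_ge0.
have [e [a [b [u [v [kab srcS tgtS ->]]]]]] := walk_crossing w iS jS.
apply: le_trans (wC1 _ _ _ v _ tgtS jS) _.
apply: (@le_trans _ _ (C1 * rho ^+ b * (B * (C2 * rho ^+ a * mnorm N x)))).
  rewrite ler_wpM2l ?mulr_ge0// (le_trans (eB _ _))// ler_wpM2l//.
  by apply: wC2; rewrite finset.in_setC.
have -> : C1 * rho ^+ b * (B * (C2 * rho ^+ a * mnorm N x)) =
    C1 * B * C2 / rho * rho ^+ k * mnorm N x.
  by rewrite kab exprS exprD; field; rewrite gt_eqF.
by rewrite ler_wpM2r ?mnorm_ge0// ler_wpM2r// lerDr addr_ge0.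
Qed.

Lemma jsr_restriction_le N T (NT : multinorm (restriction T)) :
  jsr NT <= jsr N.
Proof.
apply/ler_addgt0Pr => eps eps0.
have rho0 : 0 < jsr N + eps by rewrite ltr_wpDl ?jsr_ge0.
apply: growth_bounded_jsr_le => //.
apply: growth_bounded_indep (ltW rho0) (growth_bounded_restriction N _ _ _).
by apply: jsr_lt_growth_bounded; rewrite ltrDl.
Qed.

End Restriction.

(** * The joint spectral radius of a system with a closed part *)

Theorem proposition4 (R : realType) (xi : triplet R)
  (xi_nsc : ~ strongly_connected xi)
  (S : {set vertex xi}) (S_nonempty : S != finset.set0)
  (S_proper : S != [set: vertex xi]%SET)
  (S_closed : closed_vertices S)
  (N : multinorm xi)
  (N1 : multinorm (restriction S))
  (N2 : multinorm (restriction (finset.setC S))) :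
  jsr N = Num.max (jsr N1) (jsr N2).
Proof.
apply/eqP; rewrite eq_le ge_max !jsr_restriction_le !andbT.
apply/ler_addgt0Pr => eps eps0; set rho := _ + eps.
have max_lt : Num.max (jsr N1) (jsr N2) < rho by rewrite ltrDl.
have [lt1 lt2] : jsr N1 < rho /\ jsr N2 < rho.
  by apply/andP; rewrite -gt_max.
have rho0 : 0 < rho := le_lt_trans (jsr_ge0 N1) lt1.
apply: growth_bounded_jsr_le => //.
apply: (growth_bounded_closed N S) => //.
- exact: growth_bounded_indep (ltW rho0) (jsr_lt_growth_bounded lt1).
- exact: growth_bounded_indep (ltW rho0) (jsr_lt_growth_bounded lt2).
Qed.
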